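(* Let $G$ be a Polish group, and let $X$ be a minimal, metrizable $G$-flow such that every orbit $Gx$ ($x\in X$) is meager in $X$. Let $\pi:\widehat{X}\to X$ be the universal highly proximal extension of $X$. Then $\widehat{X}$ is non-metrizable.
   Context: All groups and spaces are Hausdorff. For a topological group $G$, a $G$-flow is a nonempty compact space $X$ with a continuous action $G\times X\to X$. A $G$-flow is minimal if every orbit is dense. A $G$-map between $G$-flows is a continuous map commuting with the $G$-actions. A $G$-map $\phi:Y\to X$ between minimal $G$-flows is highly proximal if every nonempty open $B\subseteq Y$ contains a fiber $\phi^{-1}(\{x\})$ for some $x\in X$ (equivalently, for every $x\in X$ and nonempty open $U\subseteq Y$ there is $g\in G$ with $g\phi^{-1}(\{x\})\subseteq U$). For a minimal $G$-flow $X$, a universal highly proximal extension of $X$ is a highly proximal $G$-map $\pi:\widehat{X}\to X$, with $\widehat{X}$ a minimal $G$-flow, such that for every highly proximal $G$-map $\phi:Y\to X$ ($Y$ a minimal $G$-flow) there is a $G$-map $\psi:\widehat{X}\to Y$ with $\pi=\phi\circ\psi$. It is a theorem of Auslander and Glasner that such an extension exists for every minimal $G$-flow $X$ and is unique up to isomorphism of $G$-flows over $X$. *)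

(* Defs.v *)
From HB Require Import structures.
From mathcomp Require Import all_boot all_order all_algebra.
From mathcomp Require Import all_classical all_reals all_analysis.

Set Implicit Arguments.
Unset Strict Implicit.
Unset Printing Implicit Defensive.

Local Open Scope classical_set_scope.

Section Spaces.
Variable R : realType.

Definition homeomorphic (S T : topologicalType) : Prop :=
  exists (f : S -> T) (g : T -> S),
    [/\ cancel f g, cancel g f, continuous f & continuous g].

Definition metrizable (T : topologicalType) : Prop :=
  exists M : metricType R, homeomorphic T M.

(* The library's [Uniform_isComplete] requires a distinguished point, which
   [metricType] does not provide. *)
Definition complete (U : uniformType) : Prop :=
  forall F : set_system U, ProperFilter F -> cauchy F -> exists x : U, F --> x.

Definition completely_metrizable (T : topologicalType) : Prop :=
  exists2 M : metricType R, complete M & homeomorphic T M.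

Definition separable (T : topologicalType) : Prop :=
  exists2 D : set T, countable D & dense D.

Definition polish (T : topologicalType) : Prop :=
  separable T /\ completely_metrizable T.

End Spaces.

Definition nowhere_dense (T : topologicalType) (A : set T) : Prop :=
  (closure A)° = set0.

Definition meager (T : topologicalType) (A : set T) : Prop :=
  exists2 F : nat -> set T,
    (forall n, nowhere_dense (F n)) & A `<=` \bigcup_n F n.

HB.mixin Record isTopologicalGroup G & Group G & Topological G := {
  mulg_continuous : continuous (fun p : G * G => (p.1 * p.2)%g) ;
  invg_continuous : continuous (fun x : G => (x^-1)%g)
}.

#[short(type="topologicalGroupType")]
HB.structure Definition TopologicalGroup :=
  {G of Group G & Topological G & isTopologicalGroup G}.

Record flow (G : topologicalGroupType) := Flow {
  flow_space :> topologicalType ;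
  act : G -> flow_space -> flow_space ;
  act1 : forall x, act 1%g x = x ;
  actM : forall g h x, act (g * h)%g x = act g (act h x) ;
  act_continuous : continuous (fun p : G * flow_space => act p.1 p.2) ;
  flow_nonempty : [set: flow_space] !=set0 ;
  flow_compact : compact [set: flow_space] ;
  flow_hausdorff : hausdorff_space flow_space
}.

Section Flows.
Variable G : topologicalGroupType.

Definition flow_orbit (X : flow G) (x : X) : set X :=
  range (fun g : G => act g x).

Definition minimal (X : flow G) : Prop := forall x : X, dense (flow_orbit x).

Definition gmap (Y X : flow G) (phi : Y -> X) : Prop :=
  continuous phi /\ forall (g : G) (y : Y), phi (act g y) = act g (phi y).

Definition highly_proximal (Y X : flow G) (phi : Y -> X) : Prop :=
  gmap phi /\
  forall B : set Y, open B -> B !=set0 -> exists x : X, phi @^-1` [set x] `<=` B.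

Definition universal_highly_proximal (X Xhat : flow G) (pi : Xhat -> X) : Prop :=
  [/\ minimal Xhat, highly_proximal pi
    & forall (Y : flow G) (phi : Y -> X), minimal Y -> highly_proximal phi ->
      exists2 psi : Xhat -> Y, gmap psi & pi = phi \o psi].

End Flows.

(* Main.v *)
Require Import Defs.
From HB Require Import structures.
From mathcomp Require Import all_boot all_order all_algebra.
From mathcomp Require Import all_classical all_reals all_analysis.
From mathcomp Require Import lra.

(** Write Z for the universal highly proximal extension and suppose that it is
    metrizable, hence compact with a countable base.

    Universality leaves no room above Z: every highly proximal map onto Z has a
    continuous section ([universal_section]), because an endomorphism of Z over
    X is the identity ([highly_proximal_rigid]).  This has a topological
    consequence: for A open in Z and V a neighbourhood of 1 in G, the closure of
    A lies in the interior of the closure of VA ([universal_closure_sweep]).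
    Indeed, a Urysohn-type construction along V yields an upper semicontinuous
    f on Z that is 0 on A and at least 1 off VA, and that varies little under
    group elements close to 1 ([action_urysohn]).  The closure of the graph of
    c |-> (g |-> f (g c)), with c ranging over the dense invariant set of points
    all of whose translates are continuity points of f, is a highly proximal
    extension of Z ([graph_extension]); its section extends f from that dense
    set to a continuous function on Z, which separates the closure of A from
    the complement of the closure of VA.

    Next, for every V and every nonempty open U there is a nonempty open W in U
    in which VW' is dense for each nonempty open W' in W
    ([generic_local_density]).  Otherwise U contains nonempty open sets
    K_0, K_1, ... with VK_i disjoint from K_j for distinct i and j; the
    countable base lets them be chosen to converge to a point z.  Taking for A
    the union of the K_i with i even, z lies in the closure of A, so the closure
    of VA is a neighbourhood of z and meets some K_i with i odd, although VA is
    disjoint from that K_i.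

    By Baire category in Z, some z then has a somewhere dense local orbit Vz for
    every V ([generic_point]), and highly proximal maps preserve this property
    ([somewhere_dense_image]).  On the other hand Baire category in G shows that
    a point of X with meager orbit has a nowhere dense local orbit
    ([meager_orbit_nowhere_dense]): a contradiction. *)

Import Order.TTheory GRing.Theory Num.Theory.
Import numFieldNormedType.Exports.

Set Implicit Arguments.
Unset Strict Implicit.
Unset Printing Implicit Defensive.

Local Open Scope classical_set_scope.

(** * Baire spaces *)

Definition baire_space (T : topologicalType) : Prop :=
  forall F : nat -> set T,
    (forall n, open (F n)) -> (forall n, dense (F n)) -> dense (\bigcap_n F n).

(** The common core of the Baire theorems for compact Hausdorff and for complete
    metric spaces: [small n] is the requirement put on the n-th set of a nested
    sequence so that the closures have a common point (nothing in the compact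
    case, a radius bound in the complete case). *)
Lemma shrinking_baire (T : topologicalType) (small : nat -> set (set T)) :
  regular_space T ->
  (forall n (x : T), exists2 U, nbhs x U & forall V, V `<=` U -> small n V) ->
  (forall W : nat -> set T, (forall n, W n !=set0) ->
    (forall n, W n.+1 `<=` W n) -> (forall n, small n (W n)) ->
    exists x, forall n, closure (W n) x) ->
  baire_space T.
Proof.
move=> regT smallT shrinkT F oF dF O O0 oO.
have step (nW : nat * set T) : exists W' : set T, open nW.2 -> nW.2 !=set0 ->
    [/\ open W', W' !=set0, closure W' `<=` nW.2 `&` F nW.1 & small nW.1 W'].
  case: nW => n W /=.
  have [[oW W0]|nW] := pselect (open W /\ W !=set0); last first.
    by exists set0 => oW W0; case: nW.
  have [x WFx] := dF n W W0 oW.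
  have nx : nbhs x (W `&` F n) by apply: open_nbhs_nbhs; split=> //; exact: openI.
  have [A nA clA] := regT x _ nx.
  have [U nU smU] := smallT n x.
  exists (A `&` U)°; split=> //.
  - exact: open_interior.
  - by exists x; exact: filterI.
  - apply: subset_trans clA; apply: closureS => z /interior_subset[]//.
  - by apply: smU => z /interior_subset[].
have [next nextP] := choice step.
pose fix W n := if n is n'.+1 then next (n', W n') else O.
have WP n : open (W n) /\ W n !=set0.
  by elim: n => [//|n [oW W0]] /=; have [] := nextP (n, W n) oW W0.
have WS n : [/\ open (W n.+1), W n.+1 !=set0,
    closure (W n.+1) `<=` W n `&` F n & small n (W n.+1)].
  by have [oW W0] := WP n; exact: (nextP (n, W n)).
have [||n|x clx] := shrinkT (fun n => W n.+1).
- by move=> n; case: (WS n).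
- by move=> n z /subset_closure Wz; have [_ _ /(_ z Wz)[]] := WS n.+1.
- by case: (WS n).
exists x; split; first by have [_ _ /(_ x (clx 0%N))[]] := WS 0%N.
by move=> n _; have [_ _ /(_ x (clx n))[]] := WS n.
Qed.

Lemma nested_filter (T : Type) (W : nat -> set T) :
  (forall n, W n !=set0) -> (forall n, W n.+1 `<=` W n) ->
  ProperFilter (filter_from [set: nat] W).
Proof.
move=> W0 WS; have Wle m n : (m <= n)%N -> W n `<=` W m.
  move=> /subnK <-; elim: (n - m)%N => // k ih.
  by rewrite addSn; exact: subset_trans (WS _) ih.
apply: filter_from_proper => //; apply: filter_from_filter; first by exists 0%N.
move=> i j _ _; exists (maxn i j) => // x Wx; split.
- exact: Wle (leq_maxl _ _) _ Wx.
- exact: Wle (leq_maxr _ _) _ Wx.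
Qed.

Lemma nested_compact (T : topologicalType) (W : nat -> set T) :
  compact [set: T] -> (forall n, W n !=set0) -> (forall n, W n.+1 `<=` W n) ->
  exists x, forall n, closure (W n) x.
Proof.
move=> cT W0 WS; have PF := nested_filter W0 WS.
have [|x [_ clx]] := cT _ PF; first exact: filterT.
by exists x => n B nB; apply: clx => //; exists n.
Qed.

Lemma compact_hausdorff_regular (T : topologicalType) :
  compact [set: T] -> hausdorff_space T -> regular_space T.
Proof.
move=> cT hT x; apply: (compact_regular hT cT); exact: filterT.
Qed.

Lemma compact_hausdorff_baire (T : topologicalType) :
  compact [set: T] -> hausdorff_space T -> baire_space T.
Proof.
move=> cT hT; apply: (@shrinking_baire _ (fun _ _ => True)).
- exact: compact_hausdorff_regular.
- by move=> n x; exists setT => //; exact: filterT.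
- by move=> W W0 WS _; exact: nested_compact.
Qed.

Lemma complete_baire (R : realType) (M : metricType R) :
  complete M -> baire_space M.
Proof.
move=> cM.
apply: (@shrinking_baire _ (fun n V => exists x, V `<=` ball x (n.+1%:R^-1)%R)).
- exact: uniform_regular.
- move=> n x; exists (ball x (n.+1%:R^-1)%R); last by move=> V ?; exists x.
  by apply: nbhsx_ballx; rewrite invr_gt0 ltr0n.
move=> W W0 WS smW; have PF := nested_filter W0 WS.
have [|x Wx] := cM _ PF.
  apply: cauchy_exP => e e0.
  have [|n] := @ltr_add_invr R 0%R e; first exact: e0.
  rewrite add0r => ne; have [x Wx] := smW n; exists x; exists n => //.
  by apply: subset_trans Wx _; apply: le_ball; exact: ltW.
exists x => n B /Wx [m _ WmB].
have [z [Wnz Wmz]] : (W n `&` W m) !=set0.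
  by apply: (@filter_ex _ _ PF); apply: filterI; [exists n|exists m].
by exists z; split=> //; exact: WmB.
Qed.

Lemma baire_homeomorphic (S T : topologicalType) :
  homeomorphic S T -> baire_space T -> baire_space S.
Proof.
move=> [f [g [fK gK cf cg]]] bT F oF dF O [s Os] oO.
move/continuousP : cf => cf; move/continuousP : cg => cg.
have [||||t [Ogt Fgt]] := bT (fun n => g @^-1` F n) _ _ (g @^-1` O).
- by move=> n; exact: cg.
- move=> n A [t At] oA; have [||u [Afu Fu]] := dF n (f @^-1` A).
  + by exists (g t); rewrite /= gK.
  + exact: cf.
  + by exists (f u); split=> //=; rewrite fK.
- by exists (f s); rewrite /= fK.
- exact: cg.
- by exists (g t); split=> // n _; exact: Fgt.
Qed.

Lemma baire_countable (T : topologicalType) (I : Type) (D : set I)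
    (F : I -> set T) :
  baire_space T -> countable D -> (forall i, D i -> open (F i)) ->
  (forall i, D i -> dense (F i)) -> dense (\bigcap_(i in D) F i).
Proof.
move=> bT /countable_injP[c cinj] oF dF.
pose F' n := [set x | forall i, D i -> c i = n -> F i x].
have F'E n : (exists2 i, D i & F' n = F i) \/ F' n = setT.
  have [[i [Di ci]]|nD] := pselect (exists i, D i /\ c i = n).
    left; exists i => //; apply/seteqP; split=> x; first by apply.
    move=> Fx j Dj cj; suff -> : j = i by [].
    by apply: cinj; rewrite ?inE// cj.
  by right; apply/seteqP; split=> x // _ i Di ci; case: nD; exists i.
have /= dF' : dense (\bigcap_n F' n).
  apply: bT => n; have [[i Di ->]|->] := F'E n; [exact: oF|exact: openT| |].
    exact: dF.
  by move=> O O0 _; rewrite setIT.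
move=> O O0 oO; have [x [Ox F'x]] := dF' O O0 oO.
by exists x; split=> // i Di; exact: (F'x (c i) Logic.I i Di).
Qed.

(** A point of this set decides A: it belongs to A as soon as it belongs to the
    closure of A. *)
Lemma open_dense_setUCclosure (T : topologicalType) (A : set T) :
  open A -> open (A `|` ~` closure A) /\ dense (A `|` ~` closure A).
Proof.
move=> oA; split; first by apply: openU => //; exact: closed_openC (@closed_closure _ _).
move=> O [x Ox] oO; have [clx|nclx] := pselect (closure A x); last first.
  by exists x; split=> //; right.
have [y [Ay Oy]] : (A `&` O) !=set0 by apply: clx; exact: open_nbhs_nbhs.
by exists y; split=> //; left.
Qed.

(** * Countable bases *)

Definition countably_based (T : topologicalType) (b : nat -> set T) : Prop :=
  (forall n, open (b n)) /\
  forall x A, nbhs x A -> exists n, b n x /\ b n `<=` A.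

(** The sequence lists a countable basis through an injection into the integers,
    with the empty set at the unused indices.  The point of T serves only to
    turn the metric space into a pointed one. *)
Lemma metrizable_compact_base (R : realType) (T : topologicalType) :
  metrizable R T -> compact [set: T] -> [set: T] !=set0 ->
  exists b, countably_based (T := T) b.
Proof.
move=> [M [f [g [fK gK cf cg]]]] cT [t0 _].
pose M' : pseudoPMetricType R :=
  HB.pack (Metric.sort M) (isPointed.Build (Metric.sort M) (f t0)).
have cM : compact [set: M].
  have -> : [set: M] = f @` setT.
    by apply/seteqP; split=> // x _; exists (g x).
  by apply: continuous_compact => //; exact: continuous_subspaceT.
have [B /countable_injP[c cinj] [oB bB]] := @compact_second_countable R M' cM.
exists (fun n => f @^-1` [set x | exists2 V, B V & c V = n /\ V x]); split.
  move=> n; move/continuousP : cf; apply.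
  rewrite openE => x [V BV [cV Vx]].
  have : nbhs x V by apply: open_nbhs_nbhs; split => //; exact: oB.
  by apply: filterS => y Vy; exists V.
move=> x A nA.
have [|V [BV Vfx] VA] := bB (f x) (g @^-1` A).
  by apply: cg; rewrite fK.
exists (c V); split; first by exists V.
move=> y [V' BV' [cV' V'y]]; have : (g @^-1` A) (f y).
  apply: VA; suff <- : V' = V by [].
  by apply: cinj; rewrite ?inE.
by rewrite /= fK.
Qed.

Lemma metrizable_nbhs_base (R : realType) (T : topologicalType) (x : T) :
  metrizable R T ->
  exists V : nat -> set T, (forall n, nbhs x (V n)) /\
    forall U, nbhs x U -> exists n, V n `<=` U.
Proof.
move=> [M [f [g [fK gK cf cg]]]].
exists (fun n => f @^-1` ball (f x) (n.+1%:R^-1)%R); split.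
  by move=> n; apply: cf; apply: nbhsx_ballx; rewrite invr_gt0 ltr0n.
move=> U nU.
have /nbhs_ballP[e /= e0 eU] : nbhs (f x) (g @^-1` U) by apply: cg; rewrite fK.
have [|n] := @ltr_add_invr R 0%R e; first exact: e0.
rewrite add0r => ne; exists n => y xy.
have : (g @^-1` U) (f y) by apply: eU; apply: le_ball xy; exact: ltW.
by rewrite /= fK.
Qed.

(** * Initial topologies, pointwise limits and closures *)

Lemma continuous_to_initial (S T : topologicalType) (Y : choiceType)
    (i : Y -> T) (f : S -> initial_topology i) :
  continuous (fun s => i (f s)) -> continuous f.
Proof.
move=> cif s U [N [[B oB <-] Bfs BU]].
apply: (@filterS _ _ _ ((fun s => i (f s)) @^-1` B)); first by move=> t /BU.
by apply: cif; exact: open_nbhs_nbhs.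
Qed.

Lemma continuous_to_ptws (S T : topologicalType) (I : Type)
    (f : S -> {ptws I -> T}) :
  (forall i, continuous (fun s => f s i)) -> continuous f.
Proof.
move=> cf s; apply/cvg_sup => i.
exact: (@continuous_to_initial S T _ (fun u : {ptws I -> T} => u i) f (cf i)).
Qed.

Lemma continuous_pair (S T U : topologicalType) (f : S -> T) (g : S -> U) :
  continuous f -> continuous g -> continuous (fun s => (f s, g s)).
Proof. by move=> cf cg s; apply: cvg_pair; [exact: cf|exact: cg]. Qed.

Lemma continuous_ptws_eval (T : topologicalType) (I : Type) (i : I) :
  continuous (fun u : {ptws I -> T} => u i).
Proof. exact: (@proj_continuous {classic I} (fun _ => T) i). Qed.

Lemma cluster_continuous (S T : topologicalType) (f : S -> T) (p q : S) :
  continuous f -> cluster (nbhs p) q -> cluster (nbhs (f p)) (f q).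
Proof.
move=> cf pq A B nA nB.
by have [s [As Bs]] := pq _ _ (cf p A nA) (cf q B nB); exists (f s).
Qed.

Lemma compact_set_type (T : topologicalType) (S : set T) :
  compact S -> compact [set: S].
Proof.
move=> cS F PF _.
have [|p [Sp clp]] := cS (set_val @ F) _.
  by apply: nearW => y; exact: set_valP.
exists (exist _ p (mem_set Sp)); split=> // A B FA [N [[D oD <-] Dp DB]].
have [||q [[a Aa <-] Da]] := clp (set_val @` A) D.
- by apply: (@filterS _ F _ A) => // a Aa; exists a.
- exact: open_nbhs_nbhs.
- by exists a; split=> //; exact: DB.
Qed.

Lemma closure_mem_le (R : realType) (S : topologicalType) (D : set S)
    (u v : S -> R) (p : S) :
  continuous u -> continuous v -> (forall q, D q -> (u q <= v q)%R) ->
  closure D p -> (u p <= v p)%R.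
Proof.
move=> cu cv uv clp; rewrite leNgt; apply/negP => vu.
pose m := ((u p + v p) / 2)%R.
have nu : nbhs p [set q | (m < u q)%R].
  apply: (cu p [set r | (m < r)%R]); apply: open_nbhs_nbhs; split.
    exact: open_gt.
  by rewrite /m /=; lra.
have nv : nbhs p [set q | (v q < m)%R].
  apply: (cv p [set r | (r < m)%R]); apply: open_nbhs_nbhs; split.
    exact: open_lt.
  by rewrite /m /=; lra.
have [q [Dq [/= q1 q2]]] := clp _ (filterI nu nv).
by have := uv q Dq; lra.
Qed.

Lemma continuous_add_cst (R : realType) (S : topologicalType) (u : S -> R) (e : R) :
  continuous u -> continuous (fun q => (u q + e)%R).
Proof. by move=> cu q; apply: cvgD; [exact: cu|exact: cvg_cst]. Qed.

(** * Topological groups and their actions *)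

Section Groups.
Variable G : topologicalGroupType.
Implicit Types (g h : G) (U V : set G).

Lemma nbhs1_symmetric_square U : nbhs (1%g : G) U ->
  exists V, [/\ nbhs (1%g : G) V, forall g, V g -> V g^-1%g &
    forall g h, V g -> V h -> U (g * h)%g].
Proof.
move=> nU; have := @mulg_continuous G (1%g, 1%g) U.
rewrite /= mul1g => /(_ nU) [[A B] /= [nA nB] ABU].
have nAB : nbhs (1%g : G) (A `&` B) by exact: filterI.
exists ((A `&` B) `&` [set g | (A `&` B) g^-1%g]); split.
- apply: filterI => //; apply: (@invg_continuous G 1%g (A `&` B)).
  by rewrite invg1.
- by move=> g [ABg ABVg]; split=> //=; rewrite invgK.
- by move=> g h [[Ag _] _] [[_ Bh] _]; apply: (ABU (g, h)).
Qed.

(** Successive square roots of U: the products of two elements of V_n+1 landing in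
    V_n are what makes the dyadic construction below consistent. *)
Lemma nbhs1_sequence U : nbhs (1%g : G) U ->
  exists V : nat -> set G, [/\ V 0%N `<=` U, forall n, nbhs (1%g : G) (V n),
    forall n g, V n g -> V n g^-1%g &
    forall n g h, V n.+1 g -> V n.+1 h -> V n (g * h)%g].
Proof.
move=> nU.
have half V : exists W, nbhs (1%g : G) V -> [/\ nbhs (1%g : G) W,
    forall g, W g -> W g^-1%g & forall g h, W g -> W h -> V (g * h)%g].
  have [nV|nV] := pselect (nbhs (1%g : G) V); last by exists setT.
  by have [W] := nbhs1_symmetric_square nV; exists W.
have [hf hfP] := choice half.
pose V n := iter n.+1 hf U.
have nV n : nbhs (1%g : G) (iter n hf U).
  by elim: n => //= n ih; have [] := hfP _ ih.
exists V; split=> [|n|n|n].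
- have [n1 _ h] := hfP _ nU; move=> g Vg /=.
  by rewrite -[g]mulg1; apply: h => //; exact: nbhs_singleton n1.
- exact: nV.
- by have [] := hfP _ (nV n).
- by have [] := hfP _ (nV n.+1).
Qed.

Lemma nbhs_mulgr g h U : nbhs (g * h)%g U -> nbhs g [set k | U (k * h)%g].
Proof.
move=> /(@mulg_continuous G (g, h)) [[A B] /= [nA nB] ABU].
apply: filterS nA => k Ak; apply: (ABU (k, h)); split=> //=.
exact: nbhs_singleton nB.
Qed.

Lemma nbhs_mulgl g h U : nbhs (g * h)%g U -> nbhs h [set k | U (g * k)%g].
Proof.
move=> /(@mulg_continuous G (g, h)) [[A B] /= [nA nB] ABU].
apply: filterS nB => k Bk; apply: (ABU (g, k)); split=> //=.
exact: nbhs_singleton nA.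
Qed.

Lemma nbhs1_inv U : nbhs (1%g : G) U -> nbhs (1%g : G) [set g | U g^-1%g].
Proof. by move=> nU; apply: (@invg_continuous G 1%g U); rewrite invg1. Qed.

Lemma nbhs1_conj g U : nbhs (1%g : G) U ->
  nbhs (1%g : G) [set k | U (g * k * g^-1)%g].
Proof.
move=> nU; apply: (@nbhs_mulgl g 1%g [set k | U (k * g^-1)%g]).
by apply: nbhs_mulgr; rewrite mulg1 mulgV.
Qed.

Lemma nbhs_rshift g U : nbhs (1%g : G) U -> nbhs g [set k | U (k * g^-1)%g].
Proof. by move=> nU; apply: nbhs_mulgr; rewrite mulgV. Qed.

End Groups.

Section Actions.
Variables (G : topologicalGroupType) (X : flow G).
Implicit Types (g h : G) (x : X) (V : set G) (A : set X).

Lemma actK g : cancel (@act G X g) (act g^-1%g).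
Proof. by move=> x; rewrite -actM mulVg act1. Qed.

Lemma actVK g : cancel (@act G X g^-1%g) (act g).
Proof. by move=> x; rewrite -actM mulgV act1. Qed.

Lemma continuous_actr g : continuous (@act G X g).
Proof.
move=> x U /(@act_continuous G X (g, x)) [[A B] /= [nA nB] ABU].
apply: filterS nB => y By; apply: (ABU (g, y)); split => //=.
exact: nbhs_singleton nA.
Qed.

Lemma continuous_actl x : continuous (fun g => act g x).
Proof.
move=> g U /(@act_continuous G X (g, x)) [[A B] /= [nA nB] ABU].
apply: filterS nA => h Ah; apply: (ABU (h, x)); split => //=.
exact: nbhs_singleton nB.
Qed.

Lemma open_act g A : open A -> open [set x | A (act g x)].
Proof. by move=> oA; have /continuousP := @continuous_actr g; apply. Qed.

Lemma dense_act g A : dense A -> dense [set x | A (act g x)].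
Proof.
move=> dA O [x Ox] oO.
have [||y [Oy Ay]] := dA [set x | O (act g^-1%g x)].
- by exists (act g x); rewrite /= actK.
- exact: open_act.
- by exists (act g^-1%g y); split=> //=; rewrite actVK.
Qed.

Definition sweep V A : set X := [set act g x | g in V & x in A].

Lemma open_sweep V A : open A -> open (sweep V A).
Proof.
move=> oA; rewrite openE => _ [g Vg [x Ax <-]].
have : nbhs (act g x) [set y | A (act g^-1%g y)].
  by apply: open_nbhs_nbhs; split; [exact: open_act|rewrite /= actK].
apply: filterS => y Ay; exists g => //; exists (act g^-1%g y) => //.
by rewrite actVK.
Qed.

Lemma sweepS V W A B : V `<=` W -> A `<=` B -> sweep V A `<=` sweep W B.
Proof.
by move=> VW AB _ [g Vg [x Ax <-]]; exists g; [exact: VW|exists x => //; exact: AB].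
Qed.

Lemma subset_sweep V A : V 1%g -> A `<=` sweep V A.
Proof. by move=> V1 x Ax; exists 1%g => //; exists x => //; rewrite act1. Qed.

End Actions.

(** * A Urysohn function for an action *)

Section Dyadic.
Variables (G : topologicalGroupType) (X : flow G).
Variables (V : nat -> set G) (A : set X).

(** [dyadic n k] approximates the sublevel set at k / 2 ^ n of the function under
    construction: A at 0, V_0 A at 1, everything from 2 on, and V_n+1 applied
    to the preceding set of level n at each new odd numerator of level n + 1. *)
Fixpoint dyadic (n : nat) : nat -> set X :=
  if n is m.+1 then
    fun k => if odd k then sweep (V m.+1) (dyadic m k./2) else dyadic m k./2
  else fun k => if k is l.+1 then if l is _.+1 then setT else sweep (V 0%N) A
                else A.

Lemma dyadic_open n k : open A -> open (dyadic n k).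
Proof.
move=> oA; elim: n k => [[|[|k]]|n ih k] //=; first exact: open_sweep.
- exact: openT.
- by case: ifP => _ //; exact: open_sweep.
Qed.

Lemma dyadic_double n m k : dyadic (n + m)%N (k * 2 ^ m)%N = dyadic n k.
Proof.
elim: m => [|m ih]; first by rewrite addn0 muln1.
by rewrite addnS expnS mulnCA mul2n /= odd_double doubleK.
Qed.

Hypothesis V1 : forall n, V n 1%g.
Hypothesis VM : forall n g h, V n.+1 g -> V n.+1 h -> V n (g * h)%g.

(** A single factor V_n moves one step up on the grid of mesh 2 ^ -n: at an odd
    numerator the two factors V_n+1 merge into V_n one level below. *)
Lemma dyadic_step n k : sweep (V n) (dyadic n k) `<=` dyadic n k.+1.
Proof.
elim: n k => [[|[|k]]|n ih k] //=.
rewrite uphalf_half; case: ifP => /= ok; rewrite ?add1n ?add0n //.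
apply: subset_trans (ih _) => _ [g Vg [_ [h Vh [x Ax <-]] <-]].
by rewrite -actM; exists (g * h)%g; [exact: VM|exists x].
Qed.

Lemma dyadic_le n k l : (k <= l)%N -> dyadic n k `<=` dyadic n l.
Proof.
move=> /subnK <-; elim: (l - k)%N => // m ih; rewrite addSn.
apply: subset_trans ih _; apply: subset_trans (@dyadic_step n _).
exact: subset_sweep.
Qed.

Hypothesis nV : forall n, nbhs (1%g : G) (V n).
Hypothesis VV : forall n g, V n g -> V n g^-1%g.

Variable R : realType.
Local Open Scope ring_scope.

Definition dyadic_vals (x : X) : set R :=
  [set r | exists n k, dyadic n k x /\ r = k%:R / 2 ^+ n].

Definition dyadic_inf (x : X) : R := inf (dyadic_vals x).

Lemma dyadic_vals_lb x : has_lbound (dyadic_vals x).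
Proof.
by exists 0 => _ [n [k [_ ->]]]; rewrite divr_ge0 ?ler0n ?exprn_ge0.
Qed.

Lemma dyadic_vals2 x : dyadic_vals x 2.
Proof. by exists 0%N, 2%N; split=> //; rewrite expr0 divr1. Qed.

Lemma dyadic_inf_le n k x : dyadic n k x -> dyadic_inf x <= k%:R / 2 ^+ n.
Proof. by move=> nkx; apply: ge_inf (dyadic_vals_lb x) _ _; exists n, k. Qed.

Lemma dyadic_inf_ge0 x : 0 <= dyadic_inf x.
Proof.
apply: lb_le_inf; first by exists 2; exact: dyadic_vals2.
by move=> _ [n [k [_ ->]]]; rewrite divr_ge0 ?ler0n ?exprn_ge0.
Qed.

Lemma dyadic_inf_le2 x : dyadic_inf x <= 2.
Proof. exact: ge_inf (dyadic_vals_lb x) _ (dyadic_vals2 x). Qed.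

Lemma dyadic_inf_lt r x : dyadic_inf x < r ->
  exists n k, dyadic n k x /\ k%:R / 2 ^+ n < r.
Proof.
move=> /inf_lt[|_ [n [k [nkx ->]]] ltr]; first by exists 2; exact: dyadic_vals2.
by exists n, k.
Qed.

Lemma dyadic_inf_mem n k x : dyadic_inf x < k%:R / 2 ^+ n -> dyadic n k x.
Proof.
move=> /dyadic_inf_lt [m [j [mjx]]].
rewrite ltr_pdivrMr ?exprn_gt0// mulrAC ltr_pdivlMr ?exprn_gt0//.
rewrite -!natrX -!natrM ltr_nat => /ltnW jk.
rewrite -(dyadic_double n m) addnC; apply: dyadic_le jk _ _.
by rewrite dyadic_double.
Qed.

Lemma dyadic_inf_open r : open A -> open [set x | dyadic_inf x < r].
Proof.
move=> oA; rewrite openE => x /= /dyadic_inf_lt [n [k [nkx kr]]].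
have : nbhs x (dyadic n k).
  by apply: open_nbhs_nbhs; split=> //; exact: dyadic_open.
by apply: filterS => y /dyadic_inf_le; move/le_lt_trans; apply.
Qed.

(** If k is the first integer above 2 ^ n times the value at x, then x is in
    [dyadic n k], so that g x is in [dyadic n k.+1] by [dyadic_step]. *)
Lemma dyadic_inf_act n g x : V n g -> dyadic_inf (act g x) <= dyadic_inf x + 2 / 2 ^+ n.
Proof.
move=> Vg; set k := (Num.truncn (dyadic_inf x * 2 ^+ n)).+1.
have p2 : 0 < 2 ^+ n :> R by rewrite exprn_gt0.
have f0 : 0 <= dyadic_inf x * 2 ^+ n.
  by rewrite mulr_ge0 ?dyadic_inf_ge0 ?ltW.
have nkx : dyadic n k x.
  by apply: dyadic_inf_mem; rewrite ltr_pdivlMr// truncnS_gt.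
have /dyadic_inf_le : dyadic n k.+1 (act g x).
  by apply: dyadic_step; exists g => //; exists x.
move/le_trans; apply; rewrite ler_pdivrMr// mulrDl divfK ?gt_eqF//.
rewrite /k -addn2 natrD lerD2r.
by rewrite truncn_le.
Qed.

Lemma dyadic_inf_unif (e : R) : 0 < e ->
  exists2 U, nbhs (1%g : G) U &
    forall g x, U g -> `|dyadic_inf (act g x) - dyadic_inf x| <= e.
Proof.
move=> e0.
have [n ne] : exists n, 2 / 2 ^+ n <= e.
  exists (Num.truncn (2 / e)).+1.
  rewrite ler_pdivrMr ?exprn_gt0// mulrC -ler_pdivrMr//.
  apply: (@le_trans _ _ ((Num.truncn (2 / e)).+1%:R)); first exact/ltW/truncnS_gt.
  by rewrite -natrX ler_nat; apply/ltnW/ltn_expl.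
exists (V n) => // g x Vg; rewrite ler_norml lerNl opprB !lerBlDl.
apply/andP; split; last by apply: le_trans (dyadic_inf_act _ Vg) _; rewrite lerD2l.
rewrite -{1}(actK g x); apply: le_trans (dyadic_inf_act _ (VV Vg)) _.
by rewrite lerD2l.
Qed.

Lemma dyadic_inf0 x : A x -> dyadic_inf x = 0.
Proof.
move=> Ax; apply/eqP; rewrite eq_le dyadic_inf_ge0 andbT.
by rewrite -[leRHS](mul0r (2 ^+ 0)^-1); apply: (@dyadic_inf_le 0 0).
Qed.

Lemma dyadic_inf_lt1 x : dyadic_inf x < 1 -> sweep (V 0%N) A x.
Proof. by move=> f1; apply: (@dyadic_inf_mem 0 1); rewrite expr0 divr1. Qed.

End Dyadic.

(** An upper semicontinuous Urysohn function between A and the complement of UA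
    whose oscillation under the action is uniformly controlled near 1.  A
    continuous one need not exist: it would put the closure of A inside UA. *)
Lemma action_urysohn (R : realType) (G : topologicalGroupType) (X : flow G)
    (A : set X) (U : set G) : open A -> nbhs (1%g : G) U ->
  exists f : X -> R, [/\ forall x, (0 <= f x <= 2)%R,
    forall r, open [set x | (f x < r)%R],
    forall e : R, (0 < e)%R -> exists2 W, nbhs (1%g : G) W &
      forall g x, W g -> (`|f (act g x) - f x| <= e)%R,
    forall x, A x -> f x = 0%R & forall x, (f x < 1)%R -> sweep U A x].
Proof.
move=> oA nU; have [V [VU nV VV VM]] := nbhs1_sequence nU.
have V1 n : V n 1%g by exact: nbhs_singleton.
exists (dyadic_inf V A R); split.
- by move=> x; rewrite dyadic_inf_ge0 dyadic_inf_le2.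
- by move=> r; exact: dyadic_inf_open.
- exact: dyadic_inf_unif.
- exact: dyadic_inf0.
- by move=> x /(dyadic_inf_lt1 V1 VM); exact: sweepS.
Qed.

(** * Highly proximal maps *)

Section HighlyProximal.
Variable G : topologicalGroupType.
Implicit Types X Y Z : flow G.

Lemma flow_image_closed X Y (p : Y -> X) (L : set Y) :
  continuous p -> closed L -> closed (p @` L).
Proof.
move=> cp cL; apply: compact_closed; first exact: flow_hausdorff.
apply: continuous_compact; first exact: continuous_subspaceT.
by apply: subclosed_compact cL (@flow_compact _ Y) _.
Qed.

(** Upper semicontinuity of the fibres of a map between compact spaces. *)
Lemma open_fiber_inside X Y (p : Y -> X) (B : set Y) :
  continuous p -> open B -> open [set x | p @^-1` [set x] `<=` B].
Proof.
move=> cp oB.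
have -> : [set x | p @^-1` [set x] `<=` B] = ~` (p @` (~` B)).
  apply/seteqP; split=> x /=; first by move=> h [y nBy pyx]; exact/nBy/h.
  by move=> h y pyx; apply: contrapT => nBy; apply: h; exists y.
by apply: closed_openC; apply: flow_image_closed => //; exact: open_closedC.
Qed.

(** The points whose fibre under q lies in B form an open set, which therefore
    contains a whole fibre of p. *)
Lemma highly_proximal_comp X Y Z (p : Y -> X) (q : Z -> Y) :
  highly_proximal p -> highly_proximal q -> highly_proximal (p \o q).
Proof.
move=> [[cp ep] hp] [[cq eq] hq]; split.
  split; last by move=> g z; rewrite /= eq ep.
  by move=> z; apply: continuous_comp; [exact: cq|exact: cp].
move=> B oB B0.
have [||x pxB] := hp [set y | q @^-1` [set y] `<=` B].
- exact: open_fiber_inside.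
- exact: hq.
- by exists x => z pqz; apply: (pxB (q z)).
Qed.

(** The image is closed and contains a dense orbit. *)
Lemma gmap_surjective X Y (p : Y -> X) :
  minimal X -> gmap p -> forall x, exists y, p y = x.
Proof.
move=> mX [cp ep] x.
have [y0 _] := flow_nonempty Y.
have cl : closed (range p) by apply: flow_image_closed => //; exact: closedT.
suff [y _ <-] : range p x by exists y.
apply: cl => B /nbhs_interior nB.
have [||z [+ [g _ gz]]] := mX (p y0) B°.
- by exists x; exact: nbhs_singleton nB.
- exact: open_interior.
- rewrite -gz => Bz; exists (act g (p y0)); split; last exact: interior_subset.
  by exists (act g y0).
Qed.

(** If t moves y, a small open set around y is disjoint from its image under t,
    yet it contains a whole fibre of p, which t maps into itself. *)
Lemma highly_proximal_rigid X Y (p : Y -> X) (t : Y -> Y) : minimal X ->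
  highly_proximal p -> continuous t -> (forall y, p (t y) = p y) ->
  forall y, t y = y.
Proof.
move=> mX [gp hp] ct pt y; apply: contrapT => /eqP ty.
have := @flow_hausdorff _ Y; rewrite open_hausdorff => /(_ _ _ ty).
move=> [[A B] /= [/set_mem Aty /set_mem By] [oA oB AB]].
have [||x xBA] := hp (B `&` t @^-1` A).
- by apply: openI => //; move/continuousP : ct; apply.
- by exists y.
- have [z pzx] := gmap_surjective mX gp x.
  have [_ Atz] := xBA z pzx.
  have [|Btz _] := xBA (t z); first by rewrite /= pt.
  suff : (A `&` B) (t z) by rewrite (eqP AB).
  by split.
Qed.

End HighlyProximal.

(** * A highly proximal extension from a function with small oscillation along orbits *)

Section GraphExtension.
Variables (R : realType) (G : topologicalGroupType) (X : flow G) (f : X -> R).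
Local Open Scope ring_scope.

(** Quantifying over all translates makes the set invariant under G. *)
Definition continuity_orbit : set X :=
  [set x | forall g : G, {for act g x, continuous f}].

Local Notation C := continuity_orbit.

Lemma continuity_orbit_act g x : C x -> C (act g x).
Proof. by move=> Cx h; rewrite -actM; exact: Cx. Qed.

Hypothesis f02 : forall x, 0 <= f x <= 2.
Hypothesis usc_f : forall r, open [set x | f x < r].
Hypothesis unif_f : forall e : R, 0 < e -> exists2 W, nbhs (1%g : G) W &
  forall g x, W g -> `|f (act g x) - f x| <= e.

(** An upper semicontinuous function is continuous at x as soon as x decides
    every sublevel set with rational bound, a comeager condition.  It suffices to
    impose it at the translates by a countable dense set of group elements: the
    uniform control of f near 1 carries continuity over to the other
    translates, with an error that can be made arbitrarily small. *)
Lemma dense_continuity_orbit : separable G -> baire_space X -> dense C.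
Proof.
move=> [H cH dH] bX.
pose E (r : rat) : set X := [set x | f x < ratr r].
pose F (rh : rat * G) : set X :=
  [set x | (E rh.1 `|` ~` closure (E rh.1)) (act rh.2 x)].
have dF : dense (\bigcap_(rh in [set: rat] `*` H) F rh).
  apply: baire_countable => //; first exact: countableX.
  - move=> [r h] _; apply: open_act.
    by have [] := open_dense_setUCclosure (usc_f (ratr r)).
  - move=> [r h] _; apply: dense_act.
    by have [] := open_dense_setUCclosure (usc_f (ratr r)).
move=> O O0 oO; have [x [Ox Fx]] := dF O O0 oO; exists x; split=> //.
have contH h : H h -> {for act h x, continuous f}.
  move=> Hh; apply/(@cvgrPdist_lt R R^o) => e e0.
  have [|r] := @rat_in_itvoo R (f (act h x) - e) (f (act h x)).
    by rewrite ltrBlDr ltrDl.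
  rewrite in_itv /= => /andP[er rf].
  have up : nbhs (act h x) [set y | f y < f (act h x) + e].
    by apply: open_nbhs_nbhs; split; [exact: usc_f|rewrite /= ltrDl].
  have lo : nbhs (act h x) (~` closure (E r)).
    apply: open_nbhs_nbhs; split; first exact/closed_openC/closed_closure.
    have rhH : ([set: rat] `*` H) (r, h) by [].
    case: (Fx (r, h) rhH) => //=.
    by rewrite /E /= => /lt_trans/(_ rf); rewrite ltxx.
  apply: filterS (filterI up lo) => y [/= upy loy].
  have ry : ratr r <= f y.
    by rewrite leNgt; apply/negP => yr; apply: loy; exact: subset_closure.
  by rewrite ltr_norml; apply/andP; split; lra.
move=> g; apply/(@cvgrPdist_lt R R^o) => e e0.
have e4 : 0 < e / 4 by rewrite divr_gt0.
have [W nW uW] := unif_f e4.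
(* h is close enough to g for f to change by at most e / 4 between them. *)
have [||h [Wh Hh]] := dH [set h | W (h * g^-1)%g]°.
- by exists g; rewrite /interior; exact: nbhs_rshift.
- exact: open_interior.
move/interior_subset : Wh => /= Wh.
have hgE : act (h * g^-1)%g (act g x) = act h x by rewrite -actM mulgVK.
have nh : nbhs (act g x)
    [set y | `|f (act h x) - f (act (h * g^-1)%g y)| < e / 4].
  apply: (@continuous_actr _ X (h * g^-1)%g (act g x)
    [set z | `|f (act h x) - f z| < e / 4]); rewrite hgE.
  have := contH h Hh; move/(@cvgrPdist_lt R R^o); exact.
apply: filterS nh => y /= hy; rewrite -hgE in hy.
have a1 := uW _ (act g x) Wh; have a2 := uW _ y Wh.
move: a1 a2 hy; rewrite !ler_norml !ltr_norml => /andP[? ?] /andP[? ?] /andP[? ?].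
by apply/andP; split; lra.
Qed.

Local Notation T := (X * {ptws G -> R})%type.

Definition orbit_values (x : X) : {ptws G -> R} := fun g => f (act g x).

(** Only orbits of points of [continuity_orbit] are used before closing up;
    this is what makes the fibres over these points singletons, and hence the
    extension minimal and highly proximal. *)
Definition orbit_graph : set T := closure [set (x, orbit_values x) | x in C].

Lemma continuous_coord (g : G) : continuous (fun p : T => p.2 g).
Proof.
move=> p; apply: (@continuous_comp T {ptws G -> R} R snd (fun u => u g)).
  exact: cvg_snd.
exact: continuous_ptws_eval.
Qed.

Lemma orbit_graph_range p g : orbit_graph p -> 0 <= p.2 g <= 2.
Proof.
move=> Sp; apply/andP; split.
  apply: (@closure_mem_le R _ _ (fun=> 0) (fun q : T => q.2 g) p _ _ _ Sp).
  - exact: (@cst_continuous T R).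
  - exact: continuous_coord.
  - by move=> _ [x _ <-] /=; case/andP: (f02 (act g x)).
apply: (@closure_mem_le R _ _ (fun q : T => q.2 g) (fun=> 2) p _ _ _ Sp).
- exact: continuous_coord.
- exact: (@cst_continuous T R).
- by move=> _ [x _ <-] /=; case/andP: (f02 (act g x)).
Qed.

(** The control of f near 1 is a closed condition, so it survives the closure.
    It gives the equicontinuity on which continuity of the action rests. *)
Lemma orbit_graph_unif (e : R) : 0 < e ->
  exists2 W, nbhs (1%g : G) W &
    forall p g h, orbit_graph p -> W h -> p.2 (h * g)%g <= p.2 g + e.
Proof.
move=> e0; have [W nW uW] := unif_f e0; exists W => // p g h Sp Wh.
apply: (@closure_mem_le R _ _ (fun q : T => q.2 (h * g)%g)
  (fun q : T => q.2 g + e) p _ _ _ Sp).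
- exact: continuous_coord.
- by apply: (@continuous_add_cst R T); exact: continuous_coord.
- move=> _ [x _ <-] /=; have := uW h (act g x) Wh.
  by rewrite /orbit_values actM ler_norml => /andP[_]; lra.
Qed.

(** Over x in [continuity_orbit], all approximating orbits converge pointwise to
    the orbit of x, as f is continuous at each g x. *)
Lemma orbit_graph_fiber p : orbit_graph p -> C p.1 -> p = (p.1, orbit_values p.1).
Proof.
case: p => x u /= Sp Cx; congr (_, _); apply/funext => g.
apply/eqP; rewrite -subr_eq0 -normr_le0; apply/ler_addgt0Pl => e e0.
rewrite addr0; have e2 : 0 < e / 2 by rewrite divr_gt0.
have n1 : nbhs (x, u) [set q : T | `|u g - q.2 g| < e / 2].
  have := @continuous_coord g (x, u).
  by move/(@cvgrPdist_lt R R^o)/(_ _ e2).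
have n2 : nbhs (x, u) [set q : T | `|f (act g x) - f (act g q.1)| < e / 2].
  apply: (@cvg_fst _ _ (nbhs x) (nbhs u) _
    [set y | `|f (act g x) - f (act g y)| < e / 2]).
  apply: (@continuous_actr _ X g x [set z | `|f (act g x) - f z| < e / 2]).
  have := Cx g; move/(@cvgrPdist_lt R R^o); exact.
have [_ [[y _ <-] [/= q1 q2]]] := Sp _ (filterI n1 n2).
move: q1 q2; rewrite /orbit_values !ltr_norml ler_norml.
by move=> /andP[? ?] /andP[? ?]; apply/andP; split; lra.
Qed.

Definition graph_act (g : G) (p : T) : T :=
  (act g p.1, (fun h => p.2 (h * g)%g) : {ptws G -> R}).

Lemma continuous_graph_act g : continuous (graph_act g).
Proof.
apply: continuous_pair.
  move=> p; apply: (@continuous_comp T X X fst (act g)); first exact: cvg_fst.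
  exact: continuous_actr.
by apply: continuous_to_ptws => h; exact: continuous_coord.
Qed.

Lemma orbit_graph_act g p : orbit_graph p -> orbit_graph (graph_act g p).
Proof.
move=> Sp B /(@continuous_graph_act g p) /Sp [_ [[x Cx <-] Bx]].
exists (graph_act g (x, orbit_values x)); split=> //.
exists (act g x); first exact: continuity_orbit_act.
congr (_, _); apply/funext => h.
by rewrite /orbit_values /= actM.
Qed.

Definition graph_space : topologicalType := orbit_graph.

Definition graph_pt (p : T) (Sp : orbit_graph p) : graph_space :=
  exist _ p (mem_set Sp).

Definition graph_space_act (g : G) (y : graph_space) : graph_space :=
  graph_pt (@orbit_graph_act g _ (set_valP y)).

Definition graph_val (y : graph_space) : T := set_val y.

Lemma graph_val_inj : injective graph_val.
Proof. exact: val_inj. Qed.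

Lemma graph_valP y : orbit_graph (graph_val y).
Proof. exact: set_valP. Qed.

Lemma continuous_graph_val : continuous graph_val.
Proof. exact: initial_continuous. Qed.

Lemma graph_val_act g y : graph_val (graph_space_act g y) = graph_act g (graph_val y).
Proof. by []. Qed.

Lemma graph_space_act1 y : graph_space_act 1%g y = y.
Proof.
apply: graph_val_inj; rewrite graph_val_act /graph_act act1.
rewrite [RHS]surjective_pairing; congr (_, _).
by apply/funext => h; rewrite mulg1.
Qed.

Lemma graph_space_actM g h y :
  graph_space_act (g * h)%g y = graph_space_act g (graph_space_act h y).
Proof.
apply: graph_val_inj; rewrite !graph_val_act /graph_act /= actM.
by congr (_, _); apply/funext => k; rewrite mulgA.
Qed.

(** Translation is jointly continuous: moving g to a nearby h multiplies the
    argument k g on the left by k (h g^-1) k^-1, which is close to 1, and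
    the functions in the graph change uniformly little under such factors. *)
Lemma graph_coord_act_continuous k :
  continuous (fun p : G * graph_space => (graph_val p.2).2 (k * p.1)%g).
Proof.
move=> [g y]; apply/(@cvgrPdist_lt R R^o) => e e0.
have e4 : 0 < e / 4 by rewrite divr_gt0.
have [W nW uW] := orbit_graph_unif e4.
have nW' : nbhs (1%g : G) (W `&` [set w | W w^-1%g]).
  by apply: filterI => //; exact: nbhs1_inv.
have n1 : nbhs g [set h | (W `&` [set w | W w^-1%g]) (k * (h * g^-1) * k^-1)%g].
  apply: (nbhs_mulgr (g := g) (h := g^-1%g)
    (U := [set h | (W `&` [set w | W w^-1%g]) (k * h * k^-1)%g])).
  by rewrite mulgV; exact: (nbhs1_conj k nW').
have n2 : nbhs y
    [set z | `|(graph_val y).2 (k * g)%g - (graph_val z).2 (k * g)%g| < e / 4].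
  apply: (@continuous_graph_val y
    [set p | `|(graph_val y).2 (k * g)%g - p.2 (k * g)%g| < e / 4]).
  have := @continuous_coord (k * g)%g (graph_val y).
  by move/(@cvgrPdist_lt R R^o)/(_ _ e4).
exists ([set h | (W `&` [set w | W w^-1%g]) (k * (h * g^-1) * k^-1)%g],
  [set z | `|(graph_val y).2 (k * g)%g - (graph_val z).2 (k * g)%g| < e / 4]).
  by split; [exact: n1|exact: n2].
move=> [h z] /= [[Wh WVh] yz].
have hE : ((k * (h * g^-1) * k^-1) * (k * g) = k * h)%g.
  by rewrite -!mulgA mulKg mulVg mulg1.
have a1 := uW (graph_val z) (k * g)%g _ (@graph_valP z) Wh.
have a2 := uW (graph_val z) (k * h)%g _ (@graph_valP z) WVh.
rewrite hE in a1; rewrite -[in X in X <= _]hE mulKg in a2.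
move: yz; rewrite !ltr_norml => /andP[? ?]; apply/andP; split; lra.
Qed.

Lemma graph_space_act_continuous :
  continuous (fun p : G * graph_space => graph_space_act p.1 p.2).
Proof.
apply: continuous_to_initial.
apply: (@continuous_pair _ X {ptws G -> R}
  (fun p : G * graph_space => act p.1 (graph_val p.2).1)
  (fun p : G * graph_space => fun h => (graph_val p.2).2 (h * p.1)%g)).
  move=> [g y].
  apply: (@continuous_comp _ (G * X)%type X
    (fun p : G * graph_space => (p.1, (graph_val p.2).1))
    (fun p => act p.1 p.2)); last exact: act_continuous.
  apply: (@continuous_pair _ _ _ fst
    (fun p : G * graph_space => (graph_val p.2).1)) => [p|p].
    exact: cvg_fst.
  apply: (@continuous_comp _ graph_space X snd (fun y => (graph_val y).1)).
    exact: cvg_snd.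
  apply: (@continuous_comp graph_space T X graph_val fst).
    exact: continuous_graph_val.
  exact: cvg_fst.
by apply: continuous_to_ptws => k; exact: graph_coord_act_continuous.
Qed.

Lemma graph_space_compact : compact [set: graph_space].
Proof.
apply: compact_set_type.
apply: (@subclosed_compact _ _
  ([set: X] `*` [set u : {ptws G -> R} | forall g, `[0, 2]%classic (u g)])).
- exact: closed_closure.
- apply: compact_setX; first exact: flow_compact.
  apply: (@tychonoff {classic G} (fun=> R) (fun=> `[0, 2]%classic)) => _.
  exact: segment_compact.
- move=> p Sp; split=> // g; rewrite /= in_itv /=.
  exact: orbit_graph_range.
Qed.

Lemma graph_space_hausdorff : hausdorff_space graph_space.
Proof.
move=> y z yz; apply: graph_val_inj.
have vyz := cluster_continuous continuous_graph_val yz.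
rewrite [LHS]surjective_pairing [RHS]surjective_pairing; congr (_, _).
  apply: (@flow_hausdorff _ X).
  by apply: (@cluster_continuous T X fst) vyz => p; exact: cvg_fst.
apply/funext => g; apply: (@Rhausdorff R).
exact: (cluster_continuous (@continuous_coord g) vyz).
Qed.

Definition graph_flow (ne : [set: graph_space] !=set0) : flow G :=
  Flow graph_space_act1 graph_space_actM graph_space_act_continuous
    ne graph_space_compact graph_space_hausdorff.


Definition graph_lift (x : X) (Cx : C x) : graph_space :=
  graph_pt (subset_closure (imageP (fun x => (x, orbit_values x) : T) Cx)).

Definition graph_proj (y : graph_space) : X := (graph_val y).1.

Lemma graph_fiber y x (Cx : C x) : graph_proj y = x -> y = graph_lift Cx.
Proof.
move=> yx; apply: graph_val_inj.
have := orbit_graph_fiber (@graph_valP y).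
by rewrite -/(graph_proj y) yx => /(_ Cx) ->.
Qed.

Lemma continuous_graph_proj : continuous graph_proj.
Proof.
move=> y; apply: (@continuous_comp graph_space T X graph_val fst).
  exact: continuous_graph_val.
exact: cvg_fst.
Qed.

(** The singleton fibres are dense in the extension. *)
Lemma graph_lift_dense (B : set graph_space) : open B -> B !=set0 ->
  exists x (Cx : C x), B (graph_lift Cx).
Proof.
move=> [D oD <-] [y Dy].
have [_ [[x Cx <-] Dx]] := @graph_valP y D (open_nbhs_nbhs (conj oD Dy)).
by exists x, Cx.
Qed.

Lemma graph_flow_proximal ne :
  @highly_proximal G (graph_flow ne) X graph_proj.
Proof.
split; first by split=> //; exact: continuous_graph_proj.
move=> B oB B0; have [x [Cx Bx]] := graph_lift_dense oB B0.
by exists x => y /(graph_fiber Cx) ->.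
Qed.

(** An orbit closure projects onto X, so it contains each singleton fibre, and
    these are dense. *)
Lemma graph_flow_minimal ne : minimal X -> minimal (graph_flow ne).
Proof.
move=> mX y B B0 oB; have [x [Cx Bx]] := graph_lift_dense oB B0.
pose L : set (graph_flow ne) := closure (flow_orbit (y : graph_flow ne)).
have cL : closed (graph_proj @` L).
  apply: (@flow_image_closed G X (graph_flow ne)).
    exact: continuous_graph_proj.
  exact: closed_closure.
have [z Lz zx] : (graph_proj @` L) x.
  apply: cL => D /nbhs_interior nD.
  have [||t [+ [g _ gt]]] := mX (graph_proj y) D°.
  - by exists x; exact: nbhs_singleton nD.
  - exact: open_interior.
  rewrite -gt => /interior_subset Dg; exists (act g (graph_proj y)); split=> //.
  exists (graph_space_act g y) => //.
  by apply: subset_closure; exists g.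
have zE := graph_fiber Cx zx.
have nB : nbhs z B by apply: open_nbhs_nbhs; split=> //; rewrite zE.
by have [t [ot Bt]] := Lz _ nB; exists t.
Qed.

End GraphExtension.

(** On the dense set C the discontinuous f becomes continuous after pulling back
    to Y. *)
Lemma graph_extension (R : realType) (G : topologicalGroupType) (X : flow G)
    (f : X -> R) :
  minimal X -> separable G ->
  (forall x, 0 <= f x <= 2)%R ->
  (forall r, open [set x | (f x < r)%R]) ->
  (forall e : R, (0 < e)%R -> exists2 W, nbhs (1%g : G) W &
    forall g x, W g -> (`|f (act g x) - f x| <= e)%R) ->
  exists (Y : flow G) (p : Y -> X) (F : Y -> R),
    [/\ minimal Y, highly_proximal p, continuous F &
      exists2 C, dense C & forall y, C (p y) -> F y = f (p y)].
Proof.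
move=> mX sG f02 usc_f unif_f.
have bX : baire_space X.
  apply: compact_hausdorff_baire; [exact: flow_compact|exact: flow_hausdorff].
have dC := dense_continuity_orbit usc_f unif_f sG bX.
have ne : [set: graph_space f] !=set0.
  have [x [_ Cx]] := dC setT (flow_nonempty X) openT.
  by exists (graph_lift Cx).
exists (graph_flow f02 unif_f ne), (@graph_proj R G X f),
  (fun y => (graph_val y).2 1%g); split.
- exact: graph_flow_minimal.
- exact: graph_flow_proximal.
- move=> y; apply: (@continuous_comp (graph_space f)
    (X * {ptws G -> R})%type R (@graph_val R G X f) (fun p => p.2 1%g)).
    exact: continuous_graph_val.
  exact: continuous_coord.
- exists (continuity_orbit f) => // y Cy.
  rewrite {1}(graph_fiber Cy (erefl _)) /graph_val /= /orbit_values.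
  by rewrite act1.
Qed.

(** * Universal highly proximal extensions *)

(** Universality applied to p \o q gives s, and q \o s is an endomorphism of Z
    over X. *)
Lemma universal_section (G : topologicalGroupType) (X Z Y : flow G)
    (p : Z -> X) (q : Y -> Z) : minimal X ->
  universal_highly_proximal p -> minimal Y -> highly_proximal q ->
  exists2 s : Z -> Y, continuous s & forall z, q (s z) = z.
Proof.
move=> mX [mZ hp up] mY hq.
have [s [cs _] ps] := up Y _ mY (highly_proximal_comp hp hq).
exists s => //; apply: (highly_proximal_rigid mX hp).
- have [[cq _] _] := hq => z; apply: continuous_comp; [exact: cs|exact: cq].
- by move=> z; rewrite {2}ps.
Qed.

(** If F is the continuous pullback of f on the extension and s a section, then
    F \o s agrees with f on a dense set.  It therefore vanishes on the closure
    of A, while the open set where it is less than 1 lies in the closure of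
    VA. *)
Lemma universal_closure_sweep (R : realType) (G : topologicalGroupType)
    (X Z : flow G) (p : Z -> X) (A : set Z) (V : set G) :
  minimal X -> universal_highly_proximal p -> separable G ->
  open A -> nbhs (1%g : G) V -> closure A `<=` (closure (sweep V A))°.
Proof.
move=> mX up sG oA nV.
have [f [f02 uscf uniff fA fV]] := action_urysohn R oA nV.
have mZ : minimal Z by case: up.
have [Y [q [F [mY hq cF [C dC FC]]]]] := graph_extension mZ sG f02 uscf uniff.
have [s cs qs] := universal_section mX up mY hq.
pose fc z := F (s z).
have cfc : continuous fc.
  by move=> z; apply: (@continuous_comp _ Y R s F); [exact: cs|exact: cF].
have fcC z : C z -> fc z = f z by move=> Cz; rewrite /fc FC qs.
have oU : open [set z | (fc z < 1)%R].
  by move/continuousP : cfc => /(_ [set r | (r < 1)%R]); apply; exact: open_lt.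
have UV : [set z | (fc z < 1)%R] `<=` closure (sweep V A).
  move=> z /= fz B /nbhs_interior nB.
  have [||t [[Bt ft] Ct]] := dC (B° `&` [set z | (fc z < 1)%R]).
  - by exists z; split=> //; exact: nbhs_singleton nB.
  - by apply: openI => //; exact: open_interior.
  - exists t; split; last exact: interior_subset.
    by apply: fV; rewrite -fcC.
have fA0 z : closure A z -> (fc z <= 0)%R.
  move=> clz; apply: (@closure_mem_le R Z (A `&` C) fc (fun=> 0%R) z) => //.
  - exact: cst_continuous.
  - by move=> t [At Ct]; rewrite fcC// fA.
  move=> B /nbhs_interior nB.
  have [t [At Bt]] := clz _ nB.
  have [||u [[Au Bu] Cu]] := dC (A `&` B°).
  - by exists t.
  - by apply: openI => //; exact: open_interior.
  - by exists u; split=> //; exact: interior_subset.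
move=> z /fA0 fz; apply: filterS UV _; apply: open_nbhs_nbhs; split=> //=.
by apply: le_lt_trans fz _; exact: ltr01.
Qed.

(** * Points whose local orbits are somewhere dense *)

Section Generic.
Variables (G : topologicalGroupType) (Z : flow G).
Implicit Types (V : set G) (U W : set Z).

(** One step of the construction of the separated sets: K is split off W and S is
    what remains for the later sets.  S also lies inside the n-th basic open set
    or misses it, so that in the end the sets S shrink to a point. *)
Lemma separation_step V U :
  ~ (exists W, [/\ open W, W !=set0, W `<=` U &
       forall W', open W' -> W' !=set0 -> W' `<=` W ->
         W `<=` closure (sweep V W')]) ->
  forall (b : nat -> set Z) n W, open (b n) -> open W -> W !=set0 -> W `<=` U ->
  exists K S : set Z, [/\ open K, K !=set0 & K `<=` W] /\
    [/\ open S, S !=set0, S `<=` W, S `&` sweep V K = set0 &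
        S `<=` b n \/ S `&` b n = set0].
Proof.
move=> nW b n W obn oW W0 WU.
have [K [oK K0 KW WK]] : exists K, [/\ open K, K !=set0, K `<=` W &
    ~ (W `<=` closure (sweep V K))].
  apply: contrapT => nK; apply: nW; exists W; split=> // K oK K0 KW.
  by apply: contrapT => WK; apply: nK; exists K.
have {WK}[w Ww nw] : exists2 w, W w & ~ closure (sweep V K) w.
  apply: contrapT => h; apply: WK => w Ww; apply: contrapT => nw.
  by apply: h; exists w.
pose S := W `&` ~` closure (sweep V K).
have oS : open S by apply: openI => //; exact/closed_openC/closed_closure.
have S0 : S !=set0 by exists w.
have SW : S `<=` W by move=> z [].
have SK : S `&` sweep V K = set0.
  by rewrite -subset0 => z [[_ nz] Kz]; apply: nz; exact: subset_closure.
exists K; have [[z [Sz bz]]|Sb] := pselect ((S `&` b n) !=set0).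
  exists (S `&` b n); split=> //; split.
  - exact: openI.
  - by exists z.
  - by move=> t [/SW].
  - by rewrite -subset0 => t [[St _] Kt]; rewrite -SK.
  - by left => t [].
exists S; split=> //; split=> //; right.
by rewrite -subset0 => t St; apply: Sb; exists t.
Qed.

(** If the conclusion fails, iterating [separation_step] produces open sets K_n
    that V keeps apart and that converge to a point z.  The union of those with
    even index violates the hypothesis, since those with odd index accumulate at
    z too.  Taking V symmetric lets V separate K_m from K_n in both orders. *)
Lemma generic_local_density (b : nat -> set Z) V U :
  countably_based b ->
  (forall (A : set Z) (V : set G), open A -> nbhs (1%g : G) V ->
     closure A `<=` (closure (sweep V A))°) ->
  nbhs (1%g : G) V -> open U -> U !=set0 ->
  exists W, [/\ open W, W !=set0, W `<=` U &
    forall W', open W' -> W' !=set0 -> W' `<=` W -> W `<=` closure (sweep V W')].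
Proof.
move=> [ob bP] clsw nV oU U0.
wlog VV : V nV / forall g, V g -> V g^-1%g.
  move=> wl; have nV' : nbhs (1%g : G) (V `&` [set g | V g^-1%g]).
    by apply: filterI => //; exact: nbhs1_inv.
  have [|W [oW W0 WU WV]] := wl _ nV'.
    by move=> g [Vg Vg']; split=> //=; rewrite invgK.
  exists W; split=> // W' oW' W'0 W'W.
  apply: subset_trans (WV W' oW' W'0 W'W) _.
  by apply: closureS; apply: sweepS => // g [].
apply: contrapT => /separation_step sep.
have step (nW : nat * set Z) : exists KS : set Z * set Z,
    open nW.2 -> nW.2 !=set0 -> nW.2 `<=` U ->
    [/\ open KS.1, KS.1 !=set0 & KS.1 `<=` nW.2] /\
    [/\ open KS.2, KS.2 !=set0, KS.2 `<=` nW.2, KS.2 `&` sweep V KS.1 = set0 &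
        KS.2 `<=` b nW.1 \/ KS.2 `&` b nW.1 = set0].
  case: nW => n W /=.
  have [[oW W0 WU]|nW] := pselect [/\ open W, W !=set0 & W `<=` U].
    by have [K [S KS]] := sep b n W (ob n) oW W0 WU; exists (K, S).
  by exists (set0, set0) => oW W0 WU; case: nW.
have [next nextP] := choice step.
pose fix S n := if n is m.+1 then (next (m, S m)).2 else U.
pose K n := (next (n, S n)).1.
have SP n : [/\ open (S n), S n !=set0 & S n `<=` U].
  elim: n => [|n [oS S0 SU]] /=; first by split.
  by have [_ [? ? SS _ _]] := nextP (n, S n) oS S0 SU; split=> // z /SS /SU.
have KP n : [/\ open (K n), K n !=set0 & K n `<=` S n] /\
    [/\ S n.+1 `<=` S n, S n.+1 `&` sweep V (K n) = set0 &
        S n.+1 `<=` b n \/ S n.+1 `&` b n = set0].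
  have [oS S0 SU] := SP n.
  by have [? [_ _ ? ? ?]] := nextP (n, S n) oS S0 SU.
have Sle m n : (m <= n)%N -> S n `<=` S m.
  move=> /subnK <-; elim: (n - m)%N => // k ih.
  by rewrite addSn; apply: subset_trans ih; have [_ []] := KP (k + m)%N.
have KS m n : (m <= n)%N -> K n `<=` S m.
  by move=> /Sle; apply: subset_trans; have [[]] := KP n.
have KK m n : (m < n)%N -> K n `&` sweep V (K m) = set0.
  move=> mn; rewrite -subset0 => z [/(KS _ _ mn) Sz Kz].
  by have [_ [_ <- _]] := KP m.
have KKN m n : m != n -> K n `&` sweep V (K m) = set0.
  rewrite neq_ltn => /orP[/KK//|nm]; rewrite -subset0 => z [Kz [g Vg [t Kt tz]]].
  suff : (K m `&` sweep V (K n)) t by rewrite KK.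
  split=> //; exists g^-1%g; first exact: VV.
  by exists z => //; rewrite -tz actK.
have [||z clz] := @nested_compact Z S (@flow_compact _ Z) _ _.
- by move=> n; case: (SP n).
- by move=> n; have [_ []] := KP n.
(* A neighbourhood of z contains a basic open set around z, and the remaining
   set chosen at that stage meets it, hence lies inside. *)
have absorb B : nbhs z B -> exists n, forall m, (n <= m)%N -> K m `<=` B.
  move=> nB; have [k [bz bB]] := bP z B nB.
  exists k.+1 => m km; apply: subset_trans (KS _ _ km) _.
  have [_ [_ _ [Sb|Sb]]] := KP k; first exact: subset_trans Sb bB.
  have [|t [St bt]] := clz k.+1 (b k); first exact: open_nbhs_nbhs.
  by suff : (S k.+1 `&` b k) t by rewrite Sb.
pose A := \bigcup_n K n.*2.
have oA : open A by apply: bigcup_open => n _; have [[]] := KP n.*2.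
have clA : closure A z.
  move=> B /absorb[n nB]; have [[_ [t Kt] _] _] := KP n.*2.
  exists t; split; first by exists n.
  by apply: (nB n.*2) => //; rewrite -addnn leq_addr.
have [n nA] := absorb _ (clsw A V oA nV z clA).
have [[oK [t Kt] _] _] := KP n.*2.+1.
have [||s [[g Vg [u [m _ Ku] us]] Ks]] := nA n.*2.+1 _ t Kt (K n.*2.+1).
- by rewrite ltnW// ltnS -addnn leq_addr.
- exact: open_nbhs_nbhs.
suff : (K n.*2.+1 `&` sweep V (K m.*2)) s.
  by rewrite KKN//; apply/eqP => /(congr1 odd); rewrite /= !odd_double.
by split=> //; exists g => //; exists u.
Qed.

(** Let z decide all the sets V^-1 B with B basic.  When V^-1 B is dense
    around z for every basic B in W, z belongs to each V^-1 B, so that Vz meets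
    each B: Vz is dense in W. *)
Lemma generic_point (b : nat -> set Z) (V : nat -> set G) :
  countably_based b -> (forall n, nbhs (1%g : G) (V n)) ->
  (forall V U, nbhs (1%g : G) V -> open U -> U !=set0 ->
    exists W, [/\ open W, W !=set0, W `<=` U & forall W',
      open W' -> W' !=set0 -> W' `<=` W -> W `<=` closure (sweep V W')]) ->
  exists z : Z, forall n, (closure [set act g z | g in V n])° !=set0.
Proof.
move=> [ob bP] nV locd.
pose VI n := [set g : G | V n g^-1%g].
have nVI n : nbhs (1%g : G) (VI n) by exact: nbhs1_inv.
pose good n W := open W /\ forall W', open W' -> W' !=set0 -> W' `<=` W ->
  W `<=` closure (sweep (VI n) W').
pose O n := \bigcup_(W in good n) W.
pose E (nk : nat * nat) := sweep (VI nk.1) (b nk.2) `|`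
   ~` closure (sweep (VI nk.1) (b nk.2)).
have bZ : baire_space Z.
  apply: compact_hausdorff_baire; [exact: flow_compact|exact: flow_hausdorff].
have oO n : open (O n) by apply: bigcup_open => W [].
have dO n : dense (O n).
  move=> U U0 oU; have [W [oW [w Ww] WU WV]] := locd _ _ (nVI n) oU U0.
  by exists w; split; [exact: WU|exists W].
have oEd nk : open (E nk) /\ dense (E nk).
  by apply: open_dense_setUCclosure; apply: open_sweep.
have dF : dense (\bigcap_(nk in [set: nat * nat]) (O nk.1 `&` E nk)).
  apply: baire_countable => // nk _; first by apply: openI => //; case: (oEd nk).
  by apply: denseI => //; case: (oEd nk).
have [z [_ zP]] := dF setT (flow_nonempty Z) openT.
exists z => n; have [[W [oW WV] Wz] _] := zP (n, 0%N) Logic.I.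
exists z; apply: (@filterS _ _ _ W); last exact: open_nbhs_nbhs.
move=> w Ww B nB.
have [|k [bw bWB]] := bP w (W `&` B).
  by apply: filterI => //; exact: open_nbhs_nbhs.
have clz : closure (sweep (VI n) (b k)) z.
  apply: WV => //; first by exists w.
  by move=> t /bWB[].
have [_ [[g Vg [t bt tz]]|//]] := zP (n, k) Logic.I.
exists t; split; last by have [] := bWB t bt.
by exists g^-1%g => //; rewrite -tz actK.
Qed.

(** Highly proximal maps send nonempty open sets to sets with nonempty interior:
    the points whose whole fibre lies inside form a nonempty open set. *)
Lemma somewhere_dense_image (X : flow G) (p : Z -> X) (D : set Z) :
  minimal X -> highly_proximal p ->
  (closure D)° !=set0 -> (closure (p @` D))° !=set0.
Proof.
move=> mX [gp hp] D0; have [cp _] := gp.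
have [|x xD] := hp _ _ D0; first exact: open_interior.
exists x; apply: (@filterS _ _ _ [set x | p @^-1` [set x] `<=` (closure D)°]).
  move=> u /= uD; have [z pz] := gmap_surjective mX gp u.
  have /interior_subset clz := uD z pz.
  move=> B nB; rewrite -pz in nB.
  by have [t [Dt Bt]] := clz _ (cp z B nB); exists (p t); split=> //; exists t.
apply: open_nbhs_nbhs; split=> //.
by apply: open_fiber_inside => //; exact: open_interior.
Qed.

(** G is covered by the closed sets of those g with g z in the closure of F_n, so
    one of them has nonempty interior; translating this interior to 1 gives V. *)
Lemma meager_orbit_nowhere_dense (z : Z) :
  baire_space G -> meager (flow_orbit z) ->
  exists2 V, nbhs (1%g : G) V & (closure [set act g z | g in V])° = set0.
Proof.
move=> bG [F ndF orbF].
pose H n := [set g : G | ~ closure (F n) (act g z)].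
have cz := @continuous_actl _ Z z.
have oH n : open (H n).
  have /continuousP := cz; move=> /(_ (~` closure (F n))); apply.
  exact/closed_openC/closed_closure.
have [n /denseNE[U [[g0 [oU Ug0]] UH]]] : exists n, ~ dense (H n).
  apply: contrapT => ndH.
  have [||g [_ Hg]] := bG H oH _ setT _ openT.
  - by move=> n; apply: contrapT => dn; apply: ndH; exists n.
  - by exists 1%g.
  - have [|n _ Fn] := orbF (act g z); first by exists g.
    by apply: (Hg n Logic.I); exact: subset_closure.
have UF g : U g -> closure (F n) (act g z).
  by move=> Ug; apply: contrapT => nF; suff : (U `&` H n) g by rewrite UH.
exists [set g | U (g0 * g)%g].
  by apply: nbhs_mulgl; rewrite mulg1; exact: open_nbhs_nbhs.
pose D := [set act g z | g in [set g | U (g0 * g)%g]].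
have DF : closure D `<=` [set w | closure (F n) (act g0 w)].
  have cpre : closed [set w | closure (F n) (act g0 w)].
    have /continuous_closedP := @continuous_actr _ Z g0.
    by apply; exact: closed_closure.
  move/closure_id : cpre => ->; apply: closureS => _ [g Ug <-] /=.
  by rewrite -actM; exact: UF.
rewrite -subset0 => x clx; suff : ((closure (F n))°) (act g0 x) by rewrite ndF.
apply: (@filterS _ _ _ [set u | (closure D)° (act g0^-1%g u)]).
  by move=> u /= /interior_subset /DF /=; rewrite actVK.
apply: open_nbhs_nbhs; split; first by apply: open_act; exact: open_interior.
by rewrite /= actK.
Qed.
End Generic.

(** * Non-metrizability *)

Theorem corollary3p3 (R : realType) (G : topologicalGroupType)
    (X Xhat : flow G) (pi : Xhat -> X) :
  polish R G ->
  minimal X -> metrizable R X ->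
  (forall x : X, meager (flow_orbit x)) ->
  universal_highly_proximal pi ->
  ~ metrizable R Xhat.
Proof.
move=> [sepG [M cM GM]] mX _ meagerX up metrXhat.
have bG : baire_space G := baire_homeomorphic GM (complete_baire cM).
have [b bb] := metrizable_compact_base metrXhat (@flow_compact _ Xhat)
  (flow_nonempty Xhat).
have [|V [nV baseV]] := @metrizable_nbhs_base R G 1%g; first by exists M.
have clsw A U : open A -> nbhs (1%g : G) U ->
    closure A `<=` (closure (@sweep G Xhat U A))°.
  exact: (universal_closure_sweep R mX up).
have [z zV] := generic_point bb nV
  (fun U O => generic_local_density bb clsw (V := U) (U := O)).
have [U nU nd] := meager_orbit_nowhere_dense bG (meagerX (pi z)).
have [n VU] := baseV U nU.
have [_ hp _] := up.
have [x] := somewhere_dense_image mX hp (zV n).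
suff sub : pi @` [set act g z | g in V n] `<=` [set act g (pi z) | g in U].
  by move/(interiorS (closureS sub)); rewrite nd.
move=> _ [_ [g Vg <-] <-]; exists g; first exact: VU.
by have [[_ ->] _] := hp.
Qed.
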